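(* Let $\lambda$ be an infinite cardinal, let $\nu,\mu\le\lambda$ be cardinals with $\operatorname{cf}([\lambda]^\nu,\subseteq)\le\lambda$ (this holds in particular if $\nu=1$ or $\nu=\lambda$), let $\chi$ be a cardinal and let $p:[\lambda^+]^2\to\mu$ be a partition. If $\mathrm{pr}_1(\lambda^+,\lambda\circledast\lambda^+/\nu\circledast\lambda^+,\lambda,\chi)_p$ and $\mathrm{pr}_1(\lambda^+,\lambda\circledast\lambda^+,\lambda^+,\chi)$ both hold, then $\mathrm{pr}_1(\lambda^+,\lambda\circledast\lambda^+/\nu\circledast\lambda^+,\lambda^+,\chi)_p$ holds.
   Context: $[\kappa]^2$ denotes the set of pairs $(\alpha,\beta)$ with $\alpha<\beta<\kappa$; a partition is any function $p:[\kappa]^2\to\mu$. $[\lambda]^\nu$ is the set of subsets of $\lambda$ of cardinality $\nu$, and $\operatorname{cf}([\lambda]^\nu,\subseteq)$ is the least size of a family $\mathcal F\subseteq[\lambda]^\nu$ such that every member of $[\lambda]^\nu$ is contained in some member of $\mathcal F$. For an ordinal $\sigma$, $[\kappa]^\sigma$ is the set of subsets of $\kappa$ of order type $\sigma$; $a<b$ means every element of $a$ is below every element of $b$; $[\mathcal A]^{\nu'}$ is the set of subfamilies of $\mathcal A$ of cardinality $\nu'$. Given $p:[\kappa]^2\to\mu$, a coloring $c:[\kappa]^2\to\theta$ witnesses $\mathrm{pr}_1(\kappa,\nu\circledast\kappa/\nu'\circledast\kappa,\theta,\chi)_p$ iff for every ordinal $\sigma<\chi$ and every two families $\mathcal A,\mathcal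 B\subseteq[\kappa]^\sigma$, each pairwise disjoint, with $|\mathcal A|=\nu$ and $|\mathcal B|=\kappa$, there is $\mathcal A'\in[\mathcal A]^{\nu'}$ such that for every $\tau:\mu\to\theta$ there are $a\in\mathcal A'$ and $b\in\mathcal B$ with $a<b$ and $c(\alpha,\beta)=\tau(p(\alpha,\beta))$ for all $\alpha\in a,\beta\in b$. The principle asserts such $c$ exists. $\mathrm{pr}_1(\kappa,\nu\circledast\kappa,\theta,\chi)_p$ abbreviates the case $\nu'=\nu$, and omitting the subscript $p$ means $p$ is the constant partition (one cell, $\mu=1$), i.e., the requirement is that for every color $\gamma<\theta$ there are $a\in\mathcal A'$, $b\in\mathcal B$ with $a<b$ and $c(\alpha,\beta)=\gamma$ for all $\alpha\in a,\beta\in b$. *)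

(* Defs.v *)
Definition injective {V W : Type} (f : V -> W) : Prop :=
  forall x y, f x = f y -> x = y.

Definition inj_le (V W : Type) : Prop := exists f : V -> W, injective f.

Definition infinite_type (V : Type) : Prop := inj_le nat V.

Definition eqpot {T : Type} (A : T -> Prop) (V : Type) : Prop :=
  exists f : V -> T, injective f /\ (forall t, A t <-> exists v, f v = t).

Definition subset {T : Type} (A B : T -> Prop) : Prop := forall t, A t -> B t.

(* |s| < |X|, i.e. not |X| <= |s|  (equivalent under choice). *)
Definition card_lt_set {T : Type} (s : T -> Prop) (X : Type) : Prop :=
  ~ exists f : X -> T, injective f /\ forall x, s (f x).

Definition strict_well_order {K : Type} (lt : K -> K -> Prop) : Prop :=
  (forall x, ~ lt x x) /\
  (forall x y z, lt x y -> lt y z -> lt x z) /\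
  (forall x y, lt x y \/ x = y \/ lt y x) /\
  well_founded lt.

(* (K, lt) is (order-isomorphic to) the ordinal lambda^+ where lambda = |L|:
   a well-order of cardinality > |L| all of whose proper initial
   segments have cardinality <= |L|. *)
Definition is_succ_card {K : Type} (lt : K -> K -> Prop) (L : Type) : Prop :=
  strict_well_order lt /\
  ~ inj_le K L /\
  (forall a : K, exists f : {b : K | lt b a} -> L, injective f).

Definition cf_le (L N : Type) : Prop :=
  exists F : L -> (L -> Prop),
    (forall i, eqpot (F i) N) /\
    (forall S : L -> Prop, eqpot S N -> exists i, subset S (F i)).

Definition same_otp {K : Type} (lt : K -> K -> Prop) (s a : K -> Prop) : Prop :=
  exists f : K -> K,
    (forall x y, s x -> s y -> lt x y -> lt (f x) (f y)) /\
    (forall y, a y <-> exists x, s x /\ f x = y).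

Definition pairwise_disjoint {K : Type} (A : (K -> Prop) -> Prop) : Prop :=
  forall a b, A a -> A b -> a <> b -> forall x, ~ (a x /\ b x).

Definition set_lt {K : Type} (lt : K -> K -> Prop) (a b : K -> Prop) : Prop :=
  forall x y, a x -> b y -> lt x y.

(* pr_1(kappa, nu [circledast] kappa / nu' [circledast] kappa, theta, chi)_p, where
   kappa = (K, lt), nu = |Nu|, nu' = |Nu'|, theta = |Th|, chi = |X|,
   p : [kappa]^2 -> mu = M  (only its values on pairs x < y matter).
   "for every ordinal sigma < chi and A, B subset [kappa]^sigma" is rendered
   as: for every s subset kappa with |s| < chi, and A, B all of whose
   members have the order type of s. *)
Definition pr1 {K : Type} (lt : K -> K -> Prop) (Nu Nu' Th X M : Type)
    (p : K -> K -> M) : Prop :=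
  exists c : K -> K -> Th,
    forall (s : K -> Prop), card_lt_set s X ->
    forall A B : (K -> Prop) -> Prop,
      (forall a, A a -> same_otp lt s a) ->
      (forall b, B b -> same_otp lt s b) ->
      pairwise_disjoint A -> pairwise_disjoint B ->
      eqpot A Nu -> eqpot B K ->
      exists A' : (K -> Prop) -> Prop,
        subset A' A /\ eqpot A' Nu' /\
        forall tau : M -> Th,
          exists a b, A' a /\ B b /\ set_lt lt a b /\
            forall x y, a x -> b y -> c x y = tau (p x y).

Definition const_part {K : Type} : K -> K -> unit := fun _ _ => tt.

(* Main.v *)
(* Let c0 and c1 witness the two hypotheses, fix surjections e_g : lambda -> g for
   g < lambda^+, and read each value of c0 as a pair (i, l) in lambda * lambda.
   The new coloring is c(x, y) = e_g(l), where g = c1(d_i, y) and {d_i : i < lambda}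
   is a fixed set containing lambda many disjoint copies of every relevant order
   type.  By the choice of c1 and d, for each g some i satisfies c1(d_i, y) = g for
   all y in b, for lambda^+ many b in B.  Applying c0 to these b gives A'_g of size
   nu handling all tau bounded by g; every tau is bounded since mu <= lambda.  As
   cf([lambda]^nu) <= lambda, a single A' contains A'_g for unboundedly many g. *)
Require Import Defs.
From Stdlib Require Import Wellfounded Relation_Operators Cantor.
From Stdlib Require Import ClassicalEpsilon FunctionalExtensionality PropExtensionality.

(** * Comparison of cardinalities and choice along well-founded relations *)

(** The map is total on the type and constrained only on [P], so that segments and other subsets
    compare without sigma types. *)
Definition embeds {T U : Type} (P : T -> Prop) (Q : U -> Prop) : Prop :=
  exists f : T -> U, (forall x, P x -> Q (f x)) /\
    (forall x y, P x -> P y -> f x = f y -> x = y).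

Definition full (T : Type) : T -> Prop := fun _ => True.

Definition prod_set {T U : Type} (P : T -> Prop) (Q : U -> Prop) : T * U -> Prop :=
  fun z => P (fst z) /\ Q (snd z).

Lemma embeds_refl {T : Type} (P : T -> Prop) : embeds P P.
Proof. exists (fun x => x); auto. Qed.

Lemma embeds_trans {T U V : Type} (Q : U -> Prop) (P : T -> Prop) (R : V -> Prop) :
  embeds P Q -> embeds Q R -> embeds P R.
Proof.
  intros [f [f1 f2]] [g [g1 g2]]. exists (fun x => g (f x)).
  split; [auto|]. intros x y px py e. apply f2; auto.
Qed.

Lemma embeds_subset {T : Type} (P Q : T -> Prop) : subset P Q -> embeds P Q.
Proof. intros s. exists (fun x => x); auto. Qed.

Lemma embeds_prod {T U T' U' : Type} (P : T -> Prop) (Q : U -> Prop)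
    (P' : T' -> Prop) (Q' : U' -> Prop) :
  embeds P P' -> embeds Q Q' -> embeds (prod_set P Q) (prod_set P' Q').
Proof.
  intros [f [f1 f2]] [g [g1 g2]]. exists (fun z => (f (fst z), g (snd z))). split.
  - intros [x y] [px qy]; split; simpl; auto.
  - intros [x y] [x' y'] [px qy] [px' qy'] e; simpl in *.
    injection e as e1 e2. f_equal; auto.
Qed.

Lemma embeds_of_cover {T U : Type} (x0 : U) (P : T -> Prop) (Q : U -> Prop) (g : U -> T) :
  (forall t, P t -> exists x, Q x /\ g x = t) -> embeds P Q.
Proof.
  intros h.
  pose (f t := epsilon (inhabits x0) (fun x => Q x /\ g x = t)).
  assert (hf : forall t, P t -> Q (f t) /\ g (f t) = t).
  { intros t pt. apply epsilon_spec. auto. }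
  exists f. split.
  - intros t pt. apply hf, pt.
  - intros t t' pt pt' e. rewrite <- (proj2 (hf t pt)), e. apply hf, pt'.
Qed.

(** Well-founded recursion with a choice at each stage. The second hypothesis says that [Phi w u]
    sees [u] only below [w], so the values built so far may be padded with [t0]. *)
Lemma wf_choice {W T : Type} (R : W -> W -> Prop) (t0 : T)
    (Phi : W -> (W -> T) -> T -> Prop) :
  well_founded R ->
  (forall w u u', (forall v, R v w -> u v = u' v) -> forall t, Phi w u t -> Phi w u' t) ->
  (forall w u, exists t, Phi w u t) ->
  exists f, forall w, Phi w f (f w).
Proof.
  intros wf loc ex.
  pose (extend w (rec : forall v, R v w -> T) v :=
    match excluded_middle_informative (R v w) with
    | left h => rec v h
    | right _ => t0
    end).
  pose (step w rec := epsilon (inhabits t0) (Phi w (extend w rec))).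
  pose (f := Fix wf (fun _ => T) step).
  exists f. intros w.
  assert (e : f w = step w (fun v _ => f v)).
  { unfold f at 1. rewrite Fix_eq; [reflexivity|].
    intros x g g' hg. f_equal. extensionality v. extensionality h. apply hg. }
  rewrite e. apply (loc w (extend w (fun v _ => f v))).
  - intros v h. unfold extend. destruct (excluded_middle_informative (R v w)); tauto.
  - unfold step. apply epsilon_spec, ex.
Qed.

Lemma wf_least {W : Type} (R : W -> W -> Prop) (P : W -> Prop) :
  well_founded R -> (exists w, P w) -> exists m, P m /\ forall v, R v m -> ~ P v.
Proof.
  intros wf [w pw]. apply NNPP. intros h. revert pw.
  induction w as [w IH] using (well_founded_ind wf). intros pw.
  apply h. exists w. auto.
Qed.

(** Send the points of [Q], along [R], to fresh points of [P]. If these never run out, the map is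
    injective on [Q]; if they run out at [w], the values below [w] cover [P]. *)
Lemma embeds_or_segment {W T : Type} (R : W -> W -> Prop) (t0 : T)
    (Q : W -> Prop) (P : T -> Prop) :
  well_founded R -> (forall x y, R x y \/ x = y \/ R y x) ->
  embeds Q P \/ exists w, Q w /\ embeds P (fun v => R v w /\ Q v).
Proof.
  intros wf tri.
  pose (fresh w (u : W -> T) t := P t /\ forall v, R v w -> Q v -> u v <> t).
  destruct (wf_choice R t0 (fun w u t => (exists t', fresh w u t') -> fresh w u t) wf)
    as [f hf].
  - intros w u u' e t h [t' [pt' ht']].
    destruct h as [pt ht].
    + exists t'. split; [auto|]. intros v r q. rewrite e; auto.
    + split; [auto|]. intros v r q. rewrite <- e; auto.
  - intros w u. destruct (classic (exists t', fresh w u t')) as [[t' h]|h].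
    + exists t'. auto.
    + exists t0. tauto.
  - destruct (classic (forall w, Q w -> exists t', fresh w f t')) as [h|h].
    + left. exists f. split.
      * intros w q. apply hf, h, q.
      * intros x y qx qy e. destruct (tri x y) as [r|[r|r]]; auto; exfalso.
        -- apply (proj2 (hf y (h y qy)) x r qx e).
        -- apply (proj2 (hf x (h x qx)) y r qy). auto.
    + right. apply not_all_ex_not in h as [w h]. apply imply_to_and in h as [q h].
      exists w. split; [auto|]. apply (embeds_of_cover w _ _ f).
      intros t pt. apply NNPP. intros h'. apply h. exists t. split; [auto|].
      intros v r q' e. apply h'. exists v. auto.
Qed.

(** * Squares of infinite segments *)

Lemma embeds_square_nat : embeds (prod_set (full nat) (full nat)) (full nat).
Proof.
  exists Cantor.to_nat. split; [easy|]. intros x y _ _ e.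
  rewrite <- (Cantor.cancel_of_to x), e. apply Cantor.cancel_of_to.
Qed.

Definition seg {K : Type} (lt : K -> K -> Prop) (a : K) : K -> Prop := fun x => lt x a.

Definition max_of {K : Type} (lt : K -> K -> Prop) (z : K * K) : K :=
  if excluded_middle_informative (lt (fst z) (snd z)) then snd z else fst z.

(* Goedel's well-order of K * K: compare maxima first, so that the pairs below
   z lie in the square of the segment bounded by max_of z. *)
Definition godel_lt {K : Type} (lt : K -> K -> Prop) (z w : K * K) : Prop :=
  slexprod K (K * K) lt (slexprod K K lt lt) (max_of lt z, z) (max_of lt w, w).

Lemma max_of_spec {K : Type} (lt : K -> K -> Prop) (x y : K) :
  strict_well_order lt ->
  (lt x (max_of lt (x, y)) \/ x = max_of lt (x, y)) /\
  (lt y (max_of lt (x, y)) \/ y = max_of lt (x, y)).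
Proof.
  intros (_ & _ & tri & _). unfold max_of; simpl.
  destruct (excluded_middle_informative (lt x y)); [tauto|].
  specialize (tri x y). intuition auto.
Qed.

Lemma godel_lt_wf {K : Type} (lt : K -> K -> Prop) :
  strict_well_order lt -> well_founded (godel_lt lt).
Proof.
  intros (_ & _ & _ & wf). unfold godel_lt.
  apply (wf_inverse_image _ _ _ (fun z => (max_of lt z, z))).
  auto using wf_slexprod.
Qed.

Lemma slexprod_trichotomy {A B : Type} (ltA : A -> A -> Prop) (ltB : B -> B -> Prop) :
  (forall x y, ltA x y \/ x = y \/ ltA y x) ->
  (forall x y, ltB x y \/ x = y \/ ltB y x) ->
  forall x y, slexprod A B ltA ltB x y \/ x = y \/ slexprod A B ltA ltB y x.
Proof.
  intros tA tB [a b] [a' b'].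
  destruct (tA a a') as [h|[<-|h]]; [left; now constructor| |right; right; now constructor].
  destruct (tB b b') as [h|[<-|h]]; [left; now constructor|auto|right; right; now constructor].
Qed.

Lemma godel_lt_trichotomy {K : Type} (lt : K -> K -> Prop) :
  strict_well_order lt ->
  forall x y, godel_lt lt x y \/ x = y \/ godel_lt lt y x.
Proof.
  intros (_ & _ & tri & _) x y.
  destruct (slexprod_trichotomy lt _ tri (slexprod_trichotomy lt lt tri tri)
              (max_of lt x, x) (max_of lt y, y)) as [h|[h|h]]; auto.
  injection h; auto.
Qed.

Lemma godel_lt_max {K : Type} (lt : K -> K -> Prop) (z w : K * K) :
  godel_lt lt z w -> lt (max_of lt z) (max_of lt w) \/ max_of lt z = max_of lt w.
Proof. intros h. inversion h; auto. Qed.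

(** Hessenberg's theorem, by induction on [a]. If the square does not embed, [seg lt a] embeds into
    the pairs Goedel-below some [(x, y)], hence into the square of a closed segment [J] with top [m]
    below [a]. The induction hypothesis at [m], or countability if [seg lt m] is finite, then bounds
    [seg lt a] and its square. *)
Lemma embeds_square_seg {K : Type} (lt : K -> K -> Prop) (a : K) :
  strict_well_order lt -> embeds (full nat) (seg lt a) ->
  embeds (prod_set (seg lt a) (seg lt a)) (seg lt a).
Proof.
  intros swo. pose proof swo as (irr & tr & tri & wf).
  induction a as [a IH] using (well_founded_ind wf). intros inf.
  destruct (embeds_or_segment (godel_lt lt) a (prod_set (seg lt a) (seg lt a)) (seg lt a))
    as [h|([x y] & [xa ya] & h)]; auto using godel_lt_wf, godel_lt_trichotomy.
  simpl in xa, ya.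
  set (m := max_of lt (x, y)) in *.
  assert (ma : lt m a).
  { unfold m, max_of. destruct excluded_middle_informative; auto. }
  pose (J z := lt z m \/ z = m).
  assert (hJ : embeds (seg lt a) (prod_set J J)).
  { apply (embeds_trans _ _ _ h). apply embeds_subset. intros [u v] [r _].
    apply godel_lt_max in r. destruct (max_of_spec lt u v swo) as [hu hv].
    fold m in r. unfold prod_set, J; simpl.
    destruct r as [r|r]; destruct hu as [hu|hu], hv as [hv|hv]; split; subst; eauto;
      try (left; congruence); try (right; congruence).
    all: try rewrite <- hu in *; try rewrite <- hv in *; try rewrite <- r in *; eauto. }
  destruct (classic (embeds (full nat) (seg lt m))) as [infm|finm].
  - specialize (IH m ma infm).
    assert (hm : embeds J (seg lt m)).
    { apply (embeds_trans (prod_set (seg lt m) (seg lt m))); [|exact IH].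
      destruct infm as [f [f1 f2]].
      (* The extra point [m] goes off the diagonal, all other points onto it. *)
      exists (fun z => if excluded_middle_informative (z = m) then (f 0, f 1) else (z, z)).
      split.
      - intros z [hz|hz]; destruct excluded_middle_informative; split; simpl;
          try apply f1; try easy; subst; tauto.
      - intros z w hz hw.
        do 2 destruct excluded_middle_informative; intros E; try congruence;
          injection E as E1 E2; subst; try congruence;
          assert (e0 : 0 = 1) by (apply f2; try easy; congruence); discriminate. }
    assert (ha : embeds (seg lt a) (seg lt m))
      by eauto using embeds_trans, embeds_prod.
    apply (embeds_trans (seg lt m)); [eauto using embeds_trans, embeds_prod|].
    apply embeds_subset. intros z hz. unfold seg in *. eauto.
  (* Finite segments are treated as countable ones, so Cantor pairing replaces finite arithmetic. *)
  - assert (hm : embeds (seg lt m) (full nat)).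
    { destruct (embeds_or_segment lt 0 (seg lt m) (full nat) wf tri) as [h'|(w & _ & h')];
        auto.
      destruct finm. apply (embeds_trans _ _ _ h'). apply embeds_subset.
      intros z hz; apply hz. }
    assert (hJ' : embeds J (full nat)).
    { destruct hm as [f [f1 f2]].
      exists (fun z => if excluded_middle_informative (z = m) then 0 else S (f z)).
      split; [easy|]. intros z w hz hw.
      do 2 destruct excluded_middle_informative; intros E; try congruence.
      injection E as E. destruct hz, hw; try tauto. auto. }
    assert (ha : embeds (seg lt a) (full nat)).
    { eauto using embeds_trans, embeds_prod, embeds_square_nat. }
    apply (embeds_trans (full nat)); [|exact inf].
    eauto using embeds_trans, embeds_prod, embeds_square_nat.
Qed.

(** * Arithmetic and regularity of lambda^+ *)

Lemma embeds_full_inj {T U : Type} : embeds (full T) (full U) <-> inj_le T U.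
Proof.
  split.
  - intros [f [_ f2]]. exists f. intros x y e. apply f2; easy.
  - intros [f hf]. exists f. split; [easy|]. auto.
Qed.

Lemma succ_card_inhabited {K L : Type} (lt : K -> K -> Prop) :
  is_succ_card lt L -> inhabited K.
Proof.
  intros (_ & nKL & _). apply NNPP. intros h. apply nKL.
  exists (fun k => match h (inhabits k) with end). intros k. destruct (h (inhabits k)).
Qed.

Lemma embeds_seg {K L : Type} (lt : K -> K -> Prop) (l0 : L) (a : K) :
  is_succ_card lt L -> embeds (seg lt a) (full L).
Proof.
  intros (_ & _ & small). destruct (small a) as [f hf].
  exists (fun b => match excluded_middle_informative (lt b a) with
                   | left h => f (exist _ b h) | right _ => l0 end).
  split; [easy|]. unfold seg. intros x y hx hy.
  do 2 destruct excluded_middle_informative; try tauto.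
  intros e. apply hf in e. congruence.
Qed.

(** Comparability, as [K] does not embed into [L]. Such a segment has size lambda, and through it
    facts about segments pass to [L]. *)
Lemma succ_card_segment {K L : Type} (lt : K -> K -> Prop) (l0 : L) :
  is_succ_card lt L -> exists a, embeds (full L) (seg lt a).
Proof.
  intros ((_ & _ & tri & wf) & nKL & _).
  destruct (embeds_or_segment lt l0 (full K) (full L) wf tri) as [h|(a & _ & h)].
  - destruct nKL. apply embeds_full_inj, h.
  - exists a. apply (embeds_trans _ _ _ h), embeds_subset. intros x hx; apply hx.
Qed.

Lemma embeds_square {K L : Type} (lt : K -> K -> Prop) :
  is_succ_card lt L -> infinite_type L ->
  embeds (prod_set (full L) (full L)) (full L).
Proof.
  intros succ inf. assert (inf' := proj2 embeds_full_inj inf).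
  pose proof inf as [g _]. destruct (succ_card_segment lt (g 0) succ) as [a ha].
  apply (embeds_trans (prod_set (seg lt a) (seg lt a))); [auto using embeds_prod|].
  apply (embeds_trans (seg lt a)); [|apply (embeds_seg lt (g 0) a succ)].
  apply embeds_square_seg; [apply succ|]. eauto using embeds_trans.
Qed.

Lemma embeds_prod_le {T U K L : Type} (lt : K -> K -> Prop) (P : T -> Prop) (Q : U -> Prop) :
  is_succ_card lt L -> infinite_type L ->
  embeds P (full L) -> embeds Q (full L) -> embeds (prod_set P Q) (full L).
Proof. eauto using embeds_trans, embeds_prod, embeds_square. Qed.

(* Regularity of lambda^+ : if [u] were cofinal, each z would be determined by
   some t with z <= u t together with its place in the segment below u t. *)
Lemma succ_card_bounded {K L T : Type} (lt : K -> K -> Prop) (P : T -> Prop) (u : T -> K) :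
  is_succ_card lt L -> infinite_type L -> embeds P (full L) ->
  exists z, forall t, P t -> lt (u t) z.
Proof.
  intros succ inf PL. apply NNPP. intros unb.
  pose proof succ as ((irr & tr & tri & wf) & nKL & _).
  assert (h : forall z, exists t, P t /\ ~ lt (u t) z).
  { intros z. apply NNPP. intros h. apply unb. exists z. intros t pt.
    apply NNPP. intros h'. apply h. exists t; auto. }
  apply nKL, embeds_full_inj.
  pose proof inf as [n hn].
  pose (t z := proj1_sig (constructive_indefinite_description _ (h z))).
  assert (ht : forall z, P (t z) /\ ~ lt (u (t z)) z).
  { intros z. unfold t. apply proj2_sig. }
  assert (e : exists e : K -> K -> L, forall a x y,
             lt x a -> lt y a -> e a x = e a y -> x = y).
  { exists (fun a => proj1_sig
      (constructive_indefinite_description _ (embeds_seg lt (n 0) a succ))).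
    intros a. destruct constructive_indefinite_description as [f [f1 hf]]; apply hf. }
  destruct e as [e he].
  apply (embeds_trans (prod_set P (prod_set (full L) (full L))));
    [|eauto using embeds_prod_le, embeds_square].
  (* The tags [n 0] and [n 1] separate the [z] equal to [u (t z)] from those strictly below, which
     alone have a place in the segment. *)
  exists (fun z => (t z, if excluded_middle_informative (z = u (t z)) then (n 0, n 0)
                         else (n 1, e (u (t z)) z))).
  split; [intros z _; split; [apply ht|easy]|].
  assert (n01 : n 0 <> n 1) by (intros h01; now apply hn in h01).
  assert (below : forall z, z <> u (t z) -> lt z (u (t z))).
  { intros z nz. destruct (ht z) as [_ nlt]. specialize (tri z (u (t z))). tauto. }
  intros z w _ _. do 2 destruct excluded_middle_informative; intros E;
    injection E; intros; try congruence.
  apply (he (u (t z))); auto; try congruence.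
  match goal with H : t z = t w |- _ => rewrite H end. auto.
Qed.

(** By regularity this expresses having cardinality lambda^+; see [unbounded_enumeration]. *)
Definition unbounded {K : Type} (lt : K -> K -> Prop) (S : K -> Prop) : Prop :=
  forall z, exists x, S x /\ lt z x.

Lemma not_unbounded {K : Type} (lt : K -> K -> Prop) (S : K -> Prop) :
  strict_well_order lt -> ~ unbounded lt S ->
  exists z, forall x, S x -> lt x z \/ x = z.
Proof.
  intros (_ & _ & tri & _) h. apply not_all_ex_not in h as [z h].
  exists z. intros x sx. destruct (tri x z) as [r|[r|r]]; auto.
  destruct h. exists x; auto.
Qed.

(** Otherwise each [S t] has a bound, and by regularity some [z] exceeds all these bounds; but [z]
    lies in some [S t]. *)
Lemma pigeonhole {K L T : Type} (lt : K -> K -> Prop) (P : T -> Prop) (S : T -> K -> Prop) :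
  is_succ_card lt L -> infinite_type L -> embeds P (full L) ->
  (forall x, exists t, P t /\ S t x) -> exists t, P t /\ unbounded lt (S t).
Proof.
  intros succ inf PL cov. apply NNPP. intros h.
  pose proof (proj1 succ) as swo. pose proof swo as (irr & tr & tri & _).
  destruct (succ_card_inhabited lt succ) as [k0].
  pose (b t := epsilon (inhabits k0) (fun z => forall x, S t x -> lt x z \/ x = z)).
  destruct (succ_card_bounded lt P b succ inf PL) as [z hz].
  destruct (cov z) as (t & pt & st).
  assert (hb : forall x, S t x -> lt x (b t) \/ x = b t).
  { unfold b. apply epsilon_spec, not_unbounded; auto. intros h'. apply h. eauto. }
  destruct (hb z st) as [r|r].
  - apply (irr z). eauto.
  - apply (irr z). rewrite r at 1. auto.
Qed.

Lemma unbounded_full {K L : Type} (lt : K -> K -> Prop) :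
  is_succ_card lt L -> infinite_type L -> unbounded lt (full K).
Proof.
  intros succ inf z. pose proof inf as [n hn].
  destruct (succ_card_bounded lt (fun _ : unit => True) (fun _ => z) succ inf) as [x hx].
  - exists (fun _ => n 0). split; [easy|]. intros [] []; auto.
  - exists x. split; [easy|]. now apply (hx tt).
Qed.

(** * Successive copies of an order type, and collapsing *)

Definition block_sequence {K : Type} (lt : K -> K -> Prop) (a : K) (F : K -> K -> K) : Prop :=
  (forall k x y, lt x a -> lt x y -> lt (F k x) (F k y)) /\
  (forall k k' x y, lt x a -> lt k k' -> lt (F k x) (F k' y)).

(** Lexicographic recursion on [(k, x)]: the earlier values with second coordinate below [a] number
    at most lambda, so they are bounded and [S x] has a point beyond. The sets [S x] prescribe where
    the [x]-th points of all blocks lie. *)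
Lemma succ_card_block_sequence {K L : Type} (lt : K -> K -> Prop) (a : K) (S : K -> K -> Prop) :
  is_succ_card lt L -> infinite_type L -> (forall x, unbounded lt (S x)) ->
  exists F : K -> K -> K,
    (forall k x, S x (F k x)) /\ block_sequence lt a F.
Proof.
  intros succ inf unb. pose proof succ as ((irr & tr & tri & wf) & _ & _).
  pose proof inf as [n hn].
  destruct (succ_card_inhabited lt succ) as [k0].
  pose (R := slexprod K K lt lt).
  destruct (wf_choice R k0 (fun w u t => S (snd w) t /\
              forall v, R v w -> lt (snd v) a -> lt (u v) t)) as [f hf].
  - apply wf_slexprod; auto.
  - intros w u u' e t [h1 h2]. split; [auto|]. intros v r va. rewrite <- e; auto.
  - intros [k x] u.
    destruct (succ_card_bounded lt (prod_set (fun k' => lt k' k \/ k' = k) (seg lt a)) u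
                succ inf) as [z hz].
    + apply (embeds_prod_le lt); auto; [|apply (embeds_seg lt (n 0)); auto].
      destruct (unbounded_full lt succ inf k) as (k1 & _ & hk1).
      apply (embeds_trans (seg lt k1)); [|apply (embeds_seg lt (n 0)); auto].
      apply embeds_subset. intros k' [h|h]; unfold seg; subst; eauto.
    + destruct (unb x z) as (t & st & zt). exists t. split; [auto|].
      intros [k' x'] r x'a. apply (tr _ z); [|auto]. apply hz. split; simpl; [|auto].
      inversion r; auto.
  - exists (fun k x => f (k, x)). split; [|split].
    + intros k x. apply (hf (k, x)).
    + intros k x y xa xy. apply (hf (k, y)); [now constructor|auto].
    + intros k k' x y xa kk'. apply (hf (k', y)); [now constructor|auto].
Qed.

Lemma embeds_retraction {T U : Type} (t0 : T) (P : T -> Prop) (Q : U -> Prop) :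
  embeds P Q -> exists g : U -> T, forall t, P t -> exists u, g u = t.
Proof.
  intros [f [f1 f2]].
  exists (fun u => epsilon (inhabits t0) (fun t => P t /\ f t = u)).
  intros t pt. exists (f t).
  assert (h : exists t', P t' /\ f t' = f t) by eauto.
  apply (epsilon_spec (inhabits t0)) in h as [h1 h2]. auto.
Qed.

Definition range {I T : Type} (f : I -> T) : T -> Prop := fun t => exists i, f i = t.

Lemma eqpot_range {I T : Type} (f : I -> T) : injective f -> eqpot (range f) I.
Proof. intros hf. exists f. split; [exact hf|]. intros t; split; auto. Qed.

Definition block {K : Type} (lt : K -> K -> Prop) (a : K) (f : K -> K) : K -> Prop :=
  fun y => exists x, lt x a /\ f x = y.

Lemma same_otp_trans {K : Type} (lt : K -> K -> Prop) (s t a : K -> Prop) :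
  same_otp lt s t -> same_otp lt t a -> same_otp lt s a.
Proof.
  intros [f [f1 f2]] [g [g1 g2]]. exists (fun x => g (f x)). split.
  - intros x y sx sy xy. apply g1; auto; apply f2; eauto.
  - intros y. rewrite g2. split.
    + intros (x & tx & <-). apply f2 in tx as (x' & sx' & <-). eauto.
    + intros (x & sx & <-). exists (f x). split; [apply f2|]; eauto.
Qed.

Lemma block_same_otp {K : Type} (lt : K -> K -> Prop) (a : K) (F : K -> K -> K) (k : K) :
  block_sequence lt a F -> same_otp lt (seg lt a) (block lt a (F k)).
Proof.
  intros [h _]. exists (F k). split; [auto|]. intros y. reflexivity.
Qed.

Lemma block_disjoint {K I : Type} (lt : K -> K -> Prop) (a : K) (F : K -> K -> K)
    (j : I -> K) :
  strict_well_order lt -> block_sequence lt a F ->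
  pairwise_disjoint (range (fun i => block lt a (F (j i)))).
Proof.
  intros (irr & _ & tri & _) [_ h] b b' [i <-] [i' <-] ne t [(x & xa & e) (y & ya & e')].
  subst t. destruct (tri (j i) (j i')) as [r|[r|r]].
  - apply (irr (F (j i) x)). rewrite <- e' at 2. auto.
  - apply ne. now rewrite r.
  - apply (irr (F (j i') y)). rewrite e' at 2. auto.
Qed.

(** The point [z] below [a] makes the blocks nonempty; empty blocks would all coincide. *)
Lemma block_injective {K I : Type} (lt : K -> K -> Prop) (a z : K) (F : K -> K -> K)
    (j : I -> K) :
  strict_well_order lt -> block_sequence lt a F -> lt z a -> injective j ->
  injective (fun i => block lt a (F (j i))).
Proof.
  intros (irr & _ & tri & _) [_ h] za hj.
  assert (key : forall k k', lt k k' -> block lt a (F k) <> block lt a (F k')).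
  { intros k k' r e. assert (hz : block lt a (F k) (F k z)) by (exists z; auto).
    rewrite e in hz. destruct hz as (y & ya & e').
    apply (irr (F k z)). rewrite <- e' at 2. auto. }
  intros i i' e. apply hj. destruct (tri (j i) (j i')) as [r|[r|r]]; auto.
  - destruct (key _ _ r e).
  - destruct (key _ _ r). auto.
Qed.

(** Mostowski collapse: [f k] is the least strict bound of the earlier values on [s], and [a] is the
    first point outside the image of [s]. If [a] were not below [a0], the image would cover
    [seg lt a0], giving [s] at least lambda points. *)
Lemma collapse {K L : Type} (lt : K -> K -> Prop) (s : K -> Prop) (a0 : K) :
  is_succ_card lt L -> infinite_type L ->
  embeds (full L) (seg lt a0) -> ~ embeds (full L) s ->
  exists a, lt a a0 /\ same_otp lt s (seg lt a).
Proof.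
  intros succ inf La0 Ls. pose proof succ as ((irr & tr & tri & wf) & _ & _).
  pose proof inf as [n _].
  pose (bound k (u : K -> K) t := forall j, lt j k -> s j -> lt (u j) t).
  destruct (wf_choice lt a0 (fun k u t => bound k u t /\ forall t', lt t' t -> ~ bound k u t')
              wf) as [f hf].
  - intros k u u' e t [h1 h2]. split.
    + intros j jk sj. rewrite <- e; auto.
    + intros t' t't h. apply (h2 t' t't). intros j jk sj. rewrite e; auto.
  - intros k u. apply (wf_least lt (bound k u) wf).
    destruct (succ_card_bounded lt (seg lt k) u succ inf) as [z hz].
    + apply (embeds_seg lt (n 0)), succ.
    + exists z. intros j jk _. auto.
  (* A [y] below the least bound [f x] fails to exceed some [f j] with [j] in [s] below [x]: either
     [f j = y], or induction applies to [j]. *)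
  - assert (init : forall x y, lt y (f x) -> exists j, s j /\ f j = y).
    { intros x. induction x as [x IH] using (well_founded_ind wf). intros y yx.
      pose proof (proj2 (hf x) y yx) as h.
      apply not_all_ex_not in h as [j h]. apply imply_to_and in h as [jx h].
      apply imply_to_and in h as [sj h].
      destruct (tri (f j) y) as [r|[r|r]]; [tauto|eauto|eauto]. }
    destruct (wf_least lt (fun a => ~ exists j, s j /\ f j = a) wf) as [a [ha1 ha2]].
    { apply NNPP. intros h. apply Ls, (embeds_trans _ _ _ La0).
      apply (embeds_of_cover a0 _ _ f). intros t _. apply NNPP. intros h'. apply h. eauto. }
    exists a. split.
    + apply NNPP. intros h. apply Ls, (embeds_trans _ _ _ La0).
      apply (embeds_of_cover a0 _ _ f). intros t ta. apply NNPP. intros h'.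
      apply (ha2 t); [|auto].
      destruct (tri a a0) as [r|[r|r]]; [tauto|subst; auto|eauto].
    + exists f. split.
      * intros x y sx sy xy. apply hf; auto.
      * intros y. split.
        -- intros ya. apply NNPP. exact (ha2 y ya).
        -- intros (x & sx & <-). unfold seg. destruct (tri (f x) a) as [r|[r|r]]; auto.
           ++ destruct ha1. eauto.
           ++ destruct ha1. eauto.
Qed.

Lemma unbounded_enumeration {K L : Type} (lt : K -> K -> Prop) (S : K -> Prop) :
  is_succ_card lt L -> infinite_type L -> unbounded lt S ->
  exists h : K -> K, injective h /\ forall k, S (h k).
Proof.
  intros succ inf unb. pose proof succ as ((irr & tr & tri & wf) & _ & _).
  pose proof inf as [n _]. destruct (succ_card_inhabited lt succ) as [k0].
  destruct (wf_choice lt k0 (fun k u t => S t /\ forall j, lt j k -> lt (u j) t) wf)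
    as [h hh].
  - intros k u u' e t [h1 h2]. split; [auto|]. intros j jk. rewrite <- e; auto.
  - intros k u.
    destruct (succ_card_bounded lt (seg lt k) u succ inf) as [z hz].
    + apply (embeds_seg lt (n 0)), succ.
    + destruct (unb z) as (x & sx & zx). exists x. split; [auto|]. intros j jk. eauto.
  - exists h. split; [|apply hh].
    intros x y e. destruct (tri x y) as [r|[r|r]]; auto; exfalso;
      apply (proj2 (hh _)) in r; rewrite e in r; exact (irr _ r).
Qed.

(** * Colorings with lambda^+ colors for the constant partition *)

(** A consequence of [pr1] for the constant partition, with families indexed by [L] and [K] so that
    subfamilies arise by reindexing. *)
Definition mono_witness {K : Type} (lt : K -> K -> Prop) (L X : Type) (c : K -> K -> K) : Prop :=
  forall s, card_lt_set s X -> forall A : L -> K -> Prop, forall B : K -> K -> Prop,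
    (forall l, same_otp lt s (A l)) -> (forall k, same_otp lt s (B k)) ->
    pairwise_disjoint (range A) -> pairwise_disjoint (range B) ->
    injective A -> injective B ->
    forall gamma, exists l k, forall x y, A l x -> B k y -> c x y = gamma.

Lemma pr1_mono_witness {K L X : Type} (lt : K -> K -> Prop) :
  pr1 lt L L K X unit const_part -> exists c, mono_witness lt L X c.
Proof.
  intros [c hc]. exists c. intros s sX A B hA hB dA dB iA iB gamma.
  destruct (hc s sX (range A) (range B)) as (A' & sub & _ & h);
    auto using eqpot_range; [intros a [l <-]; auto|intros b [k <-]; auto|].
  destruct (h (fun _ => gamma)) as (a & b & ha & [k <-] & _ & hab).
  apply sub in ha as [l <-]. exists l, k. exact hab.
Qed.

(* Otherwise choose gamma such that, for a point alpha_l in each of lambda many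
   blocks, c(alpha_l, _) avoids gamma on an unbounded set; sets b of size lambda
   meeting all these unbounded sets are never gamma-monochromatic with a block. *)
Lemma mono_witness_small {K L X : Type} (lt : K -> K -> Prop) (c : K -> K -> K)
    (s : K -> Prop) :
  is_succ_card lt L -> infinite_type L -> mono_witness lt L X c ->
  card_lt_set s X -> ~ embeds (full L) s.
Proof.
  intros succ inf hc sX Ls. pose proof succ as (swo & _ & _).
  pose proof swo as (irr & tr & tri & wf). pose proof inf as [n _].
  destruct (succ_card_segment lt (n 0) succ) as [a La].
  (* Since [seg lt a] has size at most lambda, it embeds into [s]. *)
  assert (aX : card_lt_set (seg lt a) X).
  { intros [g [g1 g2]]. apply sX.
    destruct (embeds_trans _ _ _ (embeds_seg lt (n 0) a succ) Ls) as [q [q1 q2]].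
    exists (fun x => q (g x)). split; [|auto]. intros x y e. apply g1, q2; auto. }
  destruct La as [i [ia ii]].
  assert (za := ia (n 0) I). set (z := i (n 0)) in *.
  destruct (succ_card_block_sequence lt a (fun _ => full K) succ inf
              (fun _ => unbounded_full lt succ inf)) as (F & _ & hF).
  (* Otherwise each color is the eventual value of [c (F (i l) z)] for some [l]. By pigeonhole one
     [l] serves two colors, which conflict beyond both thresholds. *)
  assert (hgamma : exists gamma, forall l, unbounded lt (fun y => c (F (i l) z) y <> gamma)).
  { apply NNPP. intros h.
    destruct (pigeonhole lt (full L)
      (fun l gamma => ~ unbounded lt (fun y => c (F (i l) z) y <> gamma)) succ inf
      (embeds_refl _)) as (l & _ & hl).
    - intros gamma. apply NNPP. intros h'. apply h. exists gamma. intros l.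
      apply NNPP. intros h''. apply h'. exists l. now split.
    - destruct (hl z) as (g1 & b1 & _). destruct (hl g1) as (g2 & b2 & g12).
      apply not_unbounded in b1 as [z1 b1]; auto. apply not_unbounded in b2 as [z2 b2]; auto.
      destruct (unbounded_full lt succ inf z1) as (y1 & _ & h1).
      destruct (unbounded_full lt succ inf z2) as (y2 & _ & h2).
      assert (hy : exists y, lt z1 y /\ lt z2 y).
      { destruct (tri y1 y2) as [r|[r|r]].
        - exists y2. split; eauto.
        - subst. eauto.
        - exists y1. split; eauto. }
      destruct hy as (y & y1' & y2').
      destruct (classic (c (F (i l) z) y = g1)) as [e|e].
      + destruct (b2 y) as [r|r].
        * intros e'. rewrite e in e'. subst. exact (irr _ g12).
        * apply (irr y). eauto.
        * subst. exact (irr _ y2').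
      + destruct (b1 y e) as [r|r].
        * apply (irr y). eauto.
        * subst. exact (irr _ y1'). }
  destruct hgamma as [gamma hgamma].
  (* The [i l]-th point of every block of [G] avoids [gamma] against the [z]-th point of [F (i l)];
     positions outside the range of [i] are free. *)
  destruct (succ_card_block_sequence lt a
    (fun x y => forall l, i l = x -> c (F (i l) z) y <> gamma) succ inf) as (G & G1 & hG).
  { intros x. destruct (classic (exists l, i l = x)) as [[l e]|nl].
    - intros w. destruct (hgamma l w) as (y & hy & wy). exists y. split; [|auto].
      intros l' e'. assert (l' = l) by (apply ii; [easy|easy|congruence]). now subst.
    - intros w. destruct (unbounded_full lt succ inf w) as (y & _ & wy).
      exists y. split; [|auto]. intros l e. destruct nl. eauto. }
  assert (inj_i : injective i) by (intros x y; now apply ii).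
  destruct (hc _ aX (fun l => block lt a (F (i l))) (fun k => block lt a (G k)))
    with (gamma := gamma) as (l & k & h).
  - intros l. now apply block_same_otp.
  - intros k. now apply block_same_otp.
  - now apply block_disjoint.
  - now apply (block_disjoint lt a G (fun k => k)).
  - now apply (block_injective lt a z).
  - apply (block_injective lt a z G (fun k => k)); auto. now intros x y.
  - apply (G1 k (i l) l eq_refl). apply h.
    + exists z; auto.
    + exists (i l). split; [now apply ia|auto].
Qed.

(* One set {d i} of size lambda serves all s: it contains lambda many disjoint
   copies of every order type below lambda. *)
Lemma mono_witness_uniform {K L X : Type} (lt : K -> K -> Prop) (c : K -> K -> K) :
  is_succ_card lt L -> infinite_type L -> mono_witness lt L X c ->
  exists d : L -> K,
    forall s, card_lt_set s X -> (exists x, s x) ->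
    forall B : K -> K -> Prop,
      (forall k, same_otp lt s (B k)) -> pairwise_disjoint (range B) -> injective B ->
      forall gamma, exists i, unbounded lt (fun k => forall y, B k y -> c (d i) y = gamma).
Proof.
  intros succ inf hc. pose proof succ as (swo & _ & _).
  pose proof swo as (irr & tr & tri & wf). pose proof inf as [n _].
  destruct (succ_card_segment lt (n 0) succ) as [a0 La0].
  pose (blocks a := constructive_indefinite_description _
    (succ_card_block_sequence lt a (fun _ => full K) succ inf
       (fun _ => unbounded_full lt succ inf))).
  pose (F a := proj1_sig (blocks a)).
  assert (hF : forall a, block_sequence lt a (F a)).
  { intros a. apply (proj2_sig (blocks a)). }
  pose proof La0 as [i [ia ii]].
  assert (inj_i : injective i) by (intros x y; now apply ii).
  destruct (embeds_retraction (n 0, (a0, a0))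
    (prod_set (full L) (prod_set (seg lt a0) (seg lt a0))) (full L)) as [q hq].
  { pose proof (embeds_seg lt (n 0) a0 succ).
    eauto using embeds_prod_le, embeds_refl. }
  (* [d] runs through the [x]-th points of the [i l']-th copies of [a], for all [a] and [x] below
     [a0]. *)
  pose (d l := let '(l', (a, x)) := q l in F a (i l') x). exists d.
  intros s sX [x0 sx0] B hB dB iB gamma.
  destruct (collapse lt s a0 succ inf La0) as (a & aa0 & sa).
  { eapply mono_witness_small; eauto. }
  assert (hz : exists z, lt z a).
  { destruct sa as [f [_ f2]]. exists (f x0). apply f2. eauto. }
  destruct hz as [z za].
  pose (good l k := forall y, B k y -> c (d l) y = gamma).
  (* Unboundedly many [k] without a good [l] would index a family refuting [hc] against the blocks
     of [F a]. *)
  assert (bad : ~ unbounded lt (fun k => ~ exists l, good l k)).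
  { intros h. destruct (unbounded_enumeration lt _ succ inf h) as [g [g1 g2]].
    destruct (hc s sX (fun l => block lt a (F a (i l))) (fun k => B (g k)))
      with (gamma := gamma) as (l & k & hlk); auto.
    - intros l. apply (same_otp_trans lt s (seg lt a)); auto using block_same_otp.
    - now apply block_disjoint.
    - intros b b' [k <-] [k' <-]. apply dB; [now exists (g k)|now exists (g k')].
    - now apply (block_injective lt a z).
    - intros k k' e. apply g1, iB, e.
    - apply (g2 k). destruct (hq (l, (a, z))) as [l' hl'].
      { repeat split; simpl; unfold seg; eauto. }
      exists l'. intros y yb. apply hlk; [|auto]. unfold d. rewrite hl'. exists z. auto. }
  apply not_unbounded in bad as [z0 hz0]; auto.
  (* The second alternative makes the sets cover [K]; it occurs only up to [z0], so beyond [z0] the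
     first one holds. *)
  destruct (pigeonhole lt (full L) (fun l k => good l k \/ ~ exists l', good l' k) succ inf
      (embeds_refl _)) as (l & _ & hl).
  - intros k. destruct (classic (exists l', good l' k)) as [[l' h]|h].
    + exists l'. split; [easy|]. now left.
    + exists (n 0). split; [easy|]. now right.
  - exists l. intros w.
    assert (hw : exists w', (lt w w' \/ w = w') /\ (lt z0 w' \/ z0 = w')).
    { destruct (tri w z0) as [r|[r|r]]; eauto. }
    destruct hw as (w' & h1 & h2). destruct (hl w') as (k & hk & w'k).
    exists k. split.
    + destruct hk as [hk|hk]; [exact hk|]. exfalso. apply hz0 in hk.
      apply (irr k). destruct hk, h2; subst; eauto.
    + destruct h1; subst; eauto.
Qed.

(** * Combination of the two colorings *)

Theorem theorem3p3 (L N M X K : Type) (lt : K -> K -> Prop) (p : K -> K -> M) :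
  infinite_type L ->
  inj_le N L ->
  inj_le M L ->
  cf_le L N ->
  is_succ_card lt L ->
  pr1 lt L N L X M p ->
  pr1 lt L L K X unit const_part ->
  pr1 lt L N K X M p.
Proof.
  intros inf _ ML [C [CN Ccov]] succ [c0 hc0] hmono.
  destruct (pr1_mono_witness lt hmono) as [c1 hc1].
  destruct (mono_witness_uniform lt c1 succ inf hc1) as [d hd].
  pose proof inf as [n hn]. destruct (succ_card_inhabited lt succ) as [k0].
  destruct (embeds_retraction (n 0, n 0) _ _ (embeds_square lt succ inf)) as [q hq].
  assert (he : exists e : K -> L -> K, forall g x, lt x g -> exists l, e g l = x).
  { pose (h g := constructive_indefinite_description _
      (embeds_retraction k0 _ _ (embeds_seg lt (n 0) g succ))).
    exists (fun g => proj1_sig (h g)). intros g x xg. exact (proj2_sig (h g) x xg). }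
  destruct he as [e he].
  exists (fun x y => e (c1 (d (fst (q (c0 x y)))) y) (snd (q (c0 x y)))).
  intros s sX A B hA hB dA dB [f [f1 f2]] [g [g1 g2]].
  (* If [s] were empty, every member of [A] would be the empty set, contradicting that [A] has
     infinitely many members. *)
  assert (ns : exists x, s x).
  { apply NNPP. intros es.
    assert (empty : forall l x, ~ f l x).
    { intros l x flx. destruct (hA (f l)) as [u [u1 u2]]; [apply f2; eauto|].
      destruct (proj1 (u2 x) flx) as (x' & sx' & _). eauto. }
    assert (e01 : f (n 0) = f (n 1)).
    { extensionality x. apply propositional_extensionality. split; intros h;
        destruct (empty _ _ h). }
    apply f1, hn in e01. discriminate. }
  (* For the color [gamma], the sets [f l] with [l] in [C j] suffice for all [tau] with values in
     [L]. *)
  pose (Q j gamma := exists i, forall tau : M -> L, exists l k, C j l /\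
    set_lt lt (f l) (g k) /\ (forall y, g k y -> c1 (d i) y = gamma) /\
    forall x y, f l x -> g k y -> c0 x y = tau (p x y)).
  destruct (pigeonhole lt (full L) Q succ inf (embeds_refl _)) as (j & _ & hj).
  - intros gamma.
    destruct (hd s sX ns g) with (gamma := gamma) as [i hi]; auto.
    { intros k. apply hB, g2. eauto. }
    { intros b b' hb hb'. apply dB; now apply g2. }
    destruct (unbounded_enumeration lt _ succ inf hi) as [h [h1 h2]].
    destruct (hc0 s sX A (range (fun k => g (h k)))) as (A' & sub & [u [u1 u2]] & hA'); auto.
    { intros b [k <-]. apply hB, g2. eauto. }
    { intros b b' [k <-] [k' <-]. apply dB; apply g2; eauto. }
    { now exists f. }
    { apply eqpot_range. intros k k' E. apply h1, g1, E. }
    (* Pulled back along [f], the family [A'] is a subset of [L] of size [N], so some [C j] covers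
       it. *)
    destruct (Ccov (fun l => A' (f l))) as [j hj].
    { pose (w v := epsilon (inhabits (n 0)) (fun l => f l = u v)).
      assert (hw : forall v, f (w v) = u v).
      { intros v. unfold w. apply epsilon_spec, f2, sub, u2. eauto. }
      exists w. split.
      - intros v v' E. apply u1. rewrite <- !hw. now rewrite E.
      - intros l. rewrite u2. split; intros [v hv]; exists v.
        + apply f1. rewrite hw. auto.
        + rewrite <- hw. congruence. }
    exists j. split; [easy|]. exists i. intros tau.
    destruct (hA' tau) as (a & b & ha & [k <-] & ab & hab).
    pose proof (sub a ha) as ha'. apply f2 in ha' as [l <-].
    exists l, (h k). split; [exact (hj l ha)|]. split; [exact ab|]. split; [exact (h2 k)|exact hab].
  - exists (fun a => exists l, C j l /\ f l = a). split; [|split].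
    + intros a (l & _ & <-). apply f2. eauto.
    + destruct (CN j) as [w [w1 w2]]. exists (fun v => f (w v)). split.
      * intros v v' E. apply w1, f1, E.
      * intros a. split.
        -- intros (l & cl & <-). apply w2 in cl as [v <-]. eauto.
        -- intros [v <-]. exists (w v). split; [apply w2|]; eauto.
    + intros tau.
      destruct (succ_card_bounded lt (full M) tau succ inf) as [z hz].
      { now apply embeds_full_inj. }
      destruct (hj z) as (gamma & [i hi] & zg).
      assert (htau : forall m, exists t, fst (q t) = i /\ e gamma (snd (q t)) = tau m).
      { intros m. destruct (he gamma (tau m)) as [l hl].
        { destruct succ as ((_ & tr & _) & _). apply (tr _ z); [now apply hz|auto]. }
        destruct (hq (i, l)) as [t ht]; [easy|]. exists t. rewrite ht. auto. }
      (* Ask [c0] for a color coding a pair [(i, l)] with [e gamma l = tau m]: the first entry makes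
         [c1] return [gamma], and [e gamma] then decodes the second. *)
      destruct (hi (fun m => epsilon (inhabits (n 0))
                  (fun t => fst (q t) = i /\ e gamma (snd (q t)) = tau m)))
        as (l & k & cl & ab & h1 & h0).
      exists (f l), (g k). split; [eauto|]. split; [apply g2; eauto|]. split; [auto|].
      intros x y fx gy. rewrite h0; auto.
      destruct (epsilon_spec (inhabits (n 0)) _ (htau (p x y))) as [t1 t2].
      rewrite t1, h1; auto.
Qed.
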